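(* For each $n\ge1$ there is a collection $\mathcal{I}_n$ of subsets of $[n-1]$ such that $|\mathcal{I}_n|\sim 2^{n-1}$ as $n\to\infty$ and \[ \lim_{n\to\infty}\ \max_{I\in\mathcal{I}_n}\left|\frac{n\,\beta^{\mathrm{cyc}}_n(I)}{\beta_n(I)}-1\right| = 0. \]
   Context: $[n]=\{1,\dots,n\}$. $S_n$ is the symmetric group on $[n]$ and $C_n\subseteq S_n$ is the set of permutations consisting of a single cycle of length $n$. The descent set of $\pi\in S_n$ is $D(\pi)=\{i\in[n-1]:\pi(i)>\pi(i+1)\}$. For $I\subseteq[n-1]$, $\beta_n(I)=\#\{\pi\in S_n: D(\pi)=I\}$ and $\beta^{\mathrm{cyc}}_n(I)=\#\{\pi\in C_n: D(\pi)=I\}$. $f(n)\sim g(n)$ means $\lim_{n\to\infty} g(n)/f(n)=1$. *)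

(* Defs.v *)
From HB Require Import structures.
From mathcomp Require Import all_boot all_order all_algebra all_fingroup.
From mathcomp Require Import all_classical all_reals all_analysis.
Set Implicit Arguments.
Unset Strict Implicit.
Unset Printing Implicit Defensive.
Import Order.TTheory GRing.Theory Num.Theory.
Import numFieldNormedType.Exports.
Local Open Scope classical_set_scope.
Local Open Scope ring_scope.

(* Indices start at 0: [n] is 'I_n and [n-1] is 'I_n.-1, so that i : 'I_n.-1
   stands for the position i+1 in the usual 1-based numbering. *)

Lemma succ_pos_subproof (n : nat) (i : 'I_n.-1) : (i.+1 < n)%N.
Proof. by case: n i => [|n] [i]. Qed.

Definition pos (n : nat) (i : 'I_n.-1) : 'I_n :=
  Ordinal (ltnW (succ_pos_subproof i)).

Definition succ_pos (n : nat) (i : 'I_n.-1) : 'I_n :=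
  Ordinal (succ_pos_subproof i).

Definition descent_set (n : nat) (s : 'S_n) : {set 'I_n.-1} :=
  [set i : 'I_n.-1 | (s (succ_pos i) < s (pos i))%N]%SET.

(* C_n: the only cycle of s, fixed points counting as cycles, is all of [n]. *)
Definition full_cycles (n : nat) : {set 'S_n} :=
  [set s : 'S_n | porbits s == [set [set: 'I_n]]]%SET.

Definition beta (n : nat) (I : {set 'I_n.-1}) : nat :=
  #|[set s : 'S_n | descent_set s == I]%SET|.

Definition beta_cyc (n : nat) (I : {set 'I_n.-1}) : nat :=
  #|[set s in full_cycles n | descent_set s == I]%SET|.

Definition asymp_equiv (R : realType) (f g : nat -> R) : Prop :=
  (fun n => g n / f n) @ \oo --> (1 : R).

(* Main.v *)
Require Import Defs.
From HB Require Import structures.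
From mathcomp Require Import all_boot all_order all_algebra all_fingroup.
From mathcomp Require Import all_classical all_reals all_analysis.
From mathcomp Require Import zify.
From mathcomp Require Import fintype finset.
Set Implicit Arguments.
Unset Strict Implicit.
Unset Printing Implicit Defensive.
Import Order.TTheory GRing.Theory Num.Theory.
Import numFieldNormedType.Exports.
Local Open Scope nat_scope.

(** Among the permutations whose descent set is contained in a given J, the
n-cycles have density about 1/n, with an error that is tiny in comparison with
beta_n(I) for all but a few I.

Cycles and words.  Cut [n] after the elements of J and let b send a position
to the number of its block; D(s) is contained in J exactly when s increases
inside the blocks.  A word of content J is a rearrangement of b.  Sorting the
letters stably shows that such words are as many as the permutations with
descent set inside J ([card_increasing]).  Following Gessel and Reutenauer, a
cycle s of this kind with a starting point x yields the word
b(x), b(s x), b(s^2 x), and so on.  It determines (s, x), because the order of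
the points on the orbit is the lexicographic order of the rotations of the
word ([orbit_word_inj]).  Conversely, if the rotations of a word are distinct,
ranking them turns the cyclic shift into a cycle that produces this word
([aperiodic_orbit_word]).  So n times the number of these cycles differs from
the number of all these permutations by at most the number of periodic words.
A periodic word is known from its first n/2 letters and its period, which
leaves at most n * n^(n/2) of them ([card_periodic_words]).  Inclusion and
exclusion over the subsets of I gives
    |n beta_cyc(I) - beta(I)| <= 2^n * n * n^(n/2)      ([beta_cyc_error]).

Lower bound for beta.  Let I have no run of l consecutive descents or
ascents.  Then the positions can be given heights below 2l that go up at
ascents and down at descents, and every permutation compatible with the
heights has descent set I.  Pigeonhole over the (2l)^n height words gives
n! <= (2l)^n beta(I)  ([fact_le_beta_no_long_run]).

Choice of the family.  A run of length l occurs in at most a fraction 2n/2^l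
of all sets.  With l about 2 log_2 n this fraction tends to 0, while
n! >= (n/4)^n exceeds (2l)^n times the error by a factor of at least n. *)

(** * Ranking and rearrangement *)

Lemma card_window m (A : {set 'I_m}) a l :
  (forall j, j \in A -> a <= j < a + l) -> #|A| <= l.
Proof.
move=> sub; rewrite cardE -(size_map val) -(size_iota a l).
apply: uniq_leq_size; first by rewrite (map_inj_uniq val_inj) enum_uniq.
by move=> _ /mapP[j + ->]; rewrite mem_enum mem_iota => /sub.
Qed.

(** The rank of x is the number of points with a smaller key. *)
Lemma rank_perm n (f : 'I_n -> nat) :
  injective f -> exists s : 'S_n, forall x y, (s x < s y) = (f x < f y).
Proof.
move=> f_inj.
have rk_lt (x : 'I_n) : #|[set y | f y < f x]| < n.
  rewrite -[X in _ < X]card_ord -cardsT; apply: proper_card.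
  rewrite properT; apply/eqP => /setP/(_ x).
  by rewrite !inE ltnn.
pose r x := Ordinal (rk_lt x).
have rE x y : (r x < r y) = (f x < f y).
  apply/idP/idP => [|lt_xy]; rewrite /r /=.
    apply: contraTT; rewrite -!leqNgt => le_yx.
    apply/subset_leq_card/subsetP => z; rewrite !inE => /leq_trans; exact.
  apply/proper_card/properP; split.
    by apply/subsetP => z; rewrite !inE => /ltn_trans; apply.
  by exists x; rewrite !inE ?ltnn.
have r_inj : injective r.
  move=> x y eq_xy; apply: f_inj; apply/eqP.
  by rewrite eqn_leq leqNgt -rE eq_xy ltnn leqNgt -rE eq_xy ltnn.
by exists (perm r_inj) => x y; rewrite !permE rE.
Qed.

(** The values of b and of b \o p, listed in order of position, are two sorted
lists with the same elements, and there is only one such list. *)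
Lemma monotone_rearrangement n (b : 'I_n -> nat) (p : 'S_n) :
  {homo b : x y / x <= y} -> {homo b \o p : x y / x <= y} ->
  forall x, b (p x) = b x.
Proof.
move=> b_homo bp_homo.
have srt (g : 'I_n -> nat) : {homo g : x y / x <= y} ->
    sorted leq [seq g x | x <- enum 'I_n].
  move=> g_homo.
  have : sorted leq (map val (enum 'I_n)) by rewrite val_enum_ord iota_sorted.
  rewrite !sorted_map; apply: sub_sorted => x y; exact: g_homo.
have eq_bp : [seq b x | x <- enum 'I_n] = [seq b (p x) | x <- enum 'I_n].
  apply: (sorted_eq leq_trans anti_leq); [exact: srt | exact: (srt _ bp_homo)|].
  rewrite (map_comp b p) perm_sym; apply/perm_map/uniq_perm.
  - by rewrite (map_inj_uniq perm_inj) enum_uniq.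
  - exact: enum_uniq.
  - move=> x; rewrite mem_enum inE; apply/mapP; exists ((p^-1)%g x); rewrite ?permKV //.
    by rewrite mem_enum.
by move=> x; have /eq_in_map/(_ x) := eq_bp; rewrite mem_enum => /(_ isT).
Qed.

Lemma perm_order_eq n (s t : 'S_n) :
  (forall x y, s x < s y -> t x < t y) -> s = t.
Proof.
move=> st.
have H := @monotone_rearrangement n val (s^-1 * t)%g.
apply/permP => x; apply/val_inj; have /= := H _ _ (s x); rewrite permM permK => -> //.
move=> y z; rewrite leq_eqVlt => /predU1P[/val_inj -> //|lt_yz].
by apply/ltnW; rewrite /= !permM; apply: st; rewrite !permKV.
Qed.

(** * Descent sets and words *)
Definition increasing_on_blocks n (b : 'I_n -> 'I_n) (s : 'S_n) : bool :=
  [forall x : 'I_n, forall y : 'I_n, (x < y) && (b x == b y) ==> (s x < s y)].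

Lemma increasing_on_blocksP n (b : 'I_n -> 'I_n) (s : 'S_n) :
  reflect (forall x y : 'I_n, x < y -> b x = b y -> s x < s y)
          (increasing_on_blocks b s).
Proof.
apply: (iffP forallP) => [inc x y lt_xy eq_b | inc x].
  by have /forallP/(_ y) := inc x; rewrite lt_xy eq_b eqxx.
by apply/forallP => y; apply/implyP => /andP[lt_xy /eqP]; apply: inc.
Qed.

Lemma block_subproof n (J : {set 'I_n.-1}) (x : 'I_n) :
  #|[set j in J | j < x]| < n.
Proof.
apply: leq_ltn_trans (ltn_ord x); apply: (@card_window _ _ 0) => j.
by rewrite inE add0n => /andP[].
Qed.

Definition block n (J : {set 'I_n.-1}) (x : 'I_n) : 'I_n :=
  Ordinal (block_subproof J x).

Lemma block_homo n (J : {set 'I_n.-1}) : {homo block J : x y / x <= y}.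
Proof.
move=> x y le_xy; apply/subset_leq_card/subsetP => j; rewrite !inE.
by case/andP=> -> /leq_trans; apply.
Qed.

Lemma block_succ n (J : {set 'I_n.-1}) (j : 'I_n.-1) :
  (block J (pos j) == block J (succ_pos j)) = (j \notin J).
Proof.
rewrite -val_eqE /=.
have -> : [set i in J | i < j.+1] =
    if j \in J then j |: [set i in J | i < j] else [set i in J | i < j].
  case: ifP => jJ; apply/setP => i; rewrite !inE ltnS leq_eqVlt.
    case: (eqVneq i j) => [->|]; first by rewrite jJ eqxx.
    by rewrite -val_eqE /= => /negPf ->.
  case: (eqVneq i j) => [->|]; first by rewrite jJ.
  by rewrite -val_eqE /= => /negPf ->.
case: ifP => jJ /=; last by rewrite eqxx.
by rewrite cardsU1 inE ltnn andbF /= -[X in X == _]add0n eqn_add2r.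
Qed.

(** Consecutive positions lie in the same block exactly when J does not separate
them, so a block is a maximal stretch on which no descent is permitted. *)
Lemma descent_subset n (J : {set 'I_n.-1}) (s : 'S_n) :
  (descent_set s \subset J) = increasing_on_blocks (block J) s.
Proof.
apply/subsetP/increasing_on_blocksP => [sub x y | inc j]; last first.
  rewrite inE => lt_s; apply: contraTT lt_s; rewrite -leqNgt -block_succ.
  by move/eqP=> eq_b; apply/ltnW/inc.
case: y => m; elim: m => [//|m IHm] lt_m /=; rewrite ltnS => le_xm eq_b.
have lt_m' : m < n.-1 by rewrite -ltnS (ltn_predK lt_m).
pose j : 'I_n.-1 := Ordinal lt_m'.
have sjE : Ordinal lt_m = succ_pos j by apply: val_inj.
have leb1 : block J x <= block J (pos j) by apply: block_homo.
have leb2 : block J (pos j) <= block J (succ_pos j) by apply: block_homo => /=.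
have eqb1 : block J (pos j) = block J (succ_pos j).
  by apply/val_inj/anti_leq; rewrite leb2 -sjE -eq_b leb1.
have step : s (pos j) < s (Ordinal lt_m).
  have /contra/(_ _) := sub j; rewrite -block_succ eqb1 eqxx => /(_ isT).
  rewrite inE -leqNgt leq_eqVlt sjE => /predU1P[/val_inj/perm_inj/(congr1 val)|//].
  by move=> /= /eqP; rewrite -[X in X == _]addn0 -addn1 eqn_add2l.
move: le_xm; rewrite leq_eqVlt => /predU1P[eq_xm | lt_xm].
  by rewrite (_ : x = pos j) //; apply: val_inj.
apply: ltn_trans step; apply: IHm => //.
by rewrite eq_b sjE -eqb1; congr block; apply: val_inj.
Qed.

(** The words with the same letters as b, counted with multiplicity. *)
Definition words n (b : 'I_n -> 'I_n) : {set {ffun 'I_n -> 'I_n}} :=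
  [set [ffun i => b (t i)] | t : 'S_n].

(** If s ranks the positions compatibly with the letters of the word b \o t, then
b \o t read in the order of s is weakly increasing, hence is b itself. *)
Lemma sort_word n (b : 'I_n -> 'I_n) (t s : 'S_n) :
  {homo b : x y / x <= y} ->
  (forall i j, b (t i) < b (t j) -> s i < s j) -> forall i, b (s i) = b (t i).
Proof.
move=> b_homo ts i; apply/val_inj.
have := @monotone_rearrangement n (fun x => b x) (s^-1 * t)%g b_homo _ (s i).
rewrite /= permM permK => -> // x y le_xy; rewrite /= !permM leqNgt.
by apply: contraTN le_xy => /ts; rewrite !permKV ltnNge.
Qed.

(** Standardization: the inverse of s increases on the blocks exactly when it
lists the positions of its word by letter, and from left to right among equal
letters.  This order depends only on the word. *)
Lemma card_increasing n (b : 'I_n -> 'I_n) : {homo b : x y / x <= y} ->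
  #|[set s | increasing_on_blocks b s]| = #|words b|.
Proof.
move=> b_homo.
pose w (s : 'S_n) : {ffun 'I_n -> 'I_n} := [ffun i => b ((s^-1)%g i)].
have w_inj : {in [set s | increasing_on_blocks b s] &, injective w}.
  move=> s t; rewrite !inE.
  move=> /increasing_on_blocksP inc_s /increasing_on_blocksP inc_t eq_w.
  have eq_b i : b ((s^-1)%g i) = b ((t^-1)%g i).
    by have /ffunP/(_ i) := eq_w; rewrite !ffunE.
  apply: invg_inj; apply: perm_order_eq => i j lt_ij.
  rewrite ltnNge; apply/negP => le_ji.
  have eqb : b ((s^-1)%g i) = b ((s^-1)%g j).
    apply/val_inj/anti_leq; rewrite b_homo ?(ltnW lt_ij) //= !eq_b.
    exact: b_homo.
  have := inc_s _ _ lt_ij eqb; rewrite !permKV ltnNge => /negP; apply.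
  move: le_ji; rewrite leq_eqVlt => /predU1P[/val_inj/perm_inj -> //|lt_ji].
  by have := inc_t _ _ lt_ji; rewrite -!eq_b eqb !permKV => /(_ erefl)/ltnW.
rewrite -(card_in_imset w_inj); apply: eq_card => f.
apply/imsetP/imsetP => [[s _ ->]|[t _ ->]].
  by exists (s^-1)%g.
(* The key sorts by letter first and breaks ties by position. *)
have key_inj : injective (fun i => b (t i) * n + i).
  move=> i j /(congr1 (modn^~ n)); rewrite !modnMDl !modn_small //.
  exact: val_inj.
have [s sE] := rank_perm key_inj.
have bs i : b (s i) = b (t i).
  apply: sort_word => // {}i j lt_b; rewrite sE.
  have := leq_mul lt_b (leqnn n).
  rewrite mulSn => H; apply: leq_trans (leq_trans H (leq_addr _ _)).
  by rewrite addnC ltn_add2r.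
exists (s^-1)%g; last by apply/ffunP => i; rewrite !ffunE invgK bs.
rewrite inE; apply/increasing_on_blocksP => x y lt_xy eq_b.
have := sE ((s^-1)%g x) ((s^-1)%g y).
by rewrite !permKV lt_xy -!bs !permKV eq_b ltn_add2l.
Qed.

(** * Orbit words of cycles *)

Lemma porbit_full_cycle n (s : 'S_n) x :
  s \in full_cycles n -> porbit s x = [set: 'I_n].
Proof.
rewrite inE => /eqP s_cyc; apply/set1P.
by rewrite -s_cyc; apply: imset_f.
Qed.

Lemma full_cycle_uniq n (s : 'S_n) x :
  s \in full_cycles n -> uniq (traject s x n).
Proof.
move=> s_cyc; have := uniq_traject_porbit s x.
by rewrite porbit_full_cycle // cardsT card_ord.
Qed.

Lemma iter_full_cycle n (s : 'S_n) x : s \in full_cycles n -> iter n s x = x.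
Proof.
move=> s_cyc; have := iter_porbit s x.
by rewrite porbit_full_cycle // cardsT card_ord.
Qed.

Lemma orbit_perm n (s : 'S_n) x : s \in full_cycles n ->
  exists u : 'S_n, forall i, u i = iter i s x.
Proof.
move=> s_cyc.
have u_inj : injective (fun i : 'I_n => iter i s x).
  move=> i j /eqP; rewrite -!(nth_traject s (ltn_ord _)).
  by rewrite nth_uniq ?size_traject ?full_cycle_uniq // => /eqP/val_inj.
by exists (perm u_inj) => i; rewrite permE.
Qed.

Lemma iter_modn T (f : T -> T) n m x : iter n f x = x ->
  iter (m %% n) f x = iter m f x.
Proof.
move=> fx; rewrite [in RHS](divn_eq m n) addnC iterD; congr (iter _ f _).
by elim: (m %/ n) => // k IHk; rewrite mulSn iterD -IHk fx.
Qed.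

Definition orbit_word n (b : 'I_n -> 'I_n) (p : 'S_n * 'I_n) :
  {ffun 'I_n -> 'I_n} := [ffun i : 'I_n => b (iter i p.1 p.2)].

Lemma orbit_word_mem n (b : 'I_n -> 'I_n) p :
  p.1 \in full_cycles n -> orbit_word b p \in words b.
Proof.
move=> /(@orbit_perm n p.1 p.2)[u uE]; apply/imsetP; exists u => //.
by apply/ffunP => i; rewrite !ffunE uE.
Qed.

(** Suppose that the orbit of s goes up from index i to index j and that of t does
not.  Then the letters at i and j agree, and since s and t increase on blocks, the
same disagreement occurs at i+1 and j+1, and so on for ever.  Along the orbit
of s, steps of size |i - j| then always go up or always go down, which is
absurd because n of them lead back to the start. *)
Lemma orbit_word_order n (b : 'I_n -> 'I_n) (s t : 'S_n) x y :
  {homo b : x y / x <= y} ->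
  s \in full_cycles n -> increasing_on_blocks b s -> increasing_on_blocks b t ->
  (forall m, b (iter m s x) = b (iter m t y)) ->
  forall i j, iter i s x < iter j s x -> iter i t y < iter j t y.
Proof.
move=> b_homo s_cyc /increasing_on_blocksP inc_s /increasing_on_blocksP inc_t.
move=> eq_b i j lt_ij.
rewrite ltnNge; apply/negP => le_ji.
have both m : iter (m + i) s x < iter (m + j) s x /\
              iter (m + j) t y <= iter (m + i) t y.
  elim: m => // m [lt_s le_t].
  have eqs : b (iter (m + i) s x) = b (iter (m + j) s x).
    apply/val_inj/anti_leq; rewrite b_homo ?(ltnW lt_s) //= !eq_b.
    exact: b_homo.
  split; first by rewrite !addSn /=; apply: inc_s.
  move: le_t; rewrite !addSn /= leq_eqVlt => /predU1P[/val_inj -> //|lt_t].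
  by apply/ltnW/inc_t => //; rewrite -!eq_b eqs.
have lt_s m : iter (m + i) s x < iter (m + j) s x by have [] := both m.
have [k_gt0 | ] := ltnP 0 n; last by rewrite leqNgt (leq_ltn_trans _ (ltn_ord x)).
have per m k : iter (k * n + m) s x = iter m s x.
  rewrite -(@iter_modn _ s n) ?iter_full_cycle //.
  by rewrite modnMDl iter_modn ?iter_full_cycle.
have [le_ij | lt_ji] := leqP i j.
  have up k : iter i s x < iter (k.+1 * (j - i) + i) s x.
    elim: k => [|k IHk]; first by rewrite mul1n subnK // (lt_s 0).
    apply: ltn_trans IHk _.
    have := lt_s (k.+1 * (j - i)); congr (_ < nat_of_ord (iter _ s x)); nia.
  by have := up n.-1; rewrite prednK // mulnC per ltnn.
have down k : iter (k.+1 * (i - j) + j) s x < iter j s x.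
  elim: k => [|k IHk]; first by rewrite mul1n subnK ?(ltnW lt_ji) // (lt_s 0).
  apply: ltn_trans IHk.
  have := lt_s (k.+1 * (i - j)); congr (nat_of_ord (iter _ s x) < _); nia.
by have := down n.-1; rewrite prednK // mulnC per ltnn.
Qed.

(** The points of each orbit are ranked by the word alone, so the two orbits
visit the same points in the same order. *)
Lemma orbit_word_inj n (b : 'I_n -> 'I_n) : {homo b : x y / x <= y} ->
  {in [set p : 'S_n * 'I_n | (p.1 \in full_cycles n) && increasing_on_blocks b p.1] &,
   injective (orbit_word b)}.
Proof.
move=> b_homo [s x] [t y].
rewrite in_set => /andP[/= s_cyc inc_s]; rewrite in_set => /andP[/= t_cyc inc_t] eq_w.
have n_gt0 : 0 < n by apply: leq_ltn_trans (ltn_ord x).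
have eq_b m : b (iter m s x) = b (iter m t y).
  rewrite -(@iter_modn _ s n) ?iter_full_cycle // -(@iter_modn _ t n) ?iter_full_cycle //.
  by have /ffunP/(_ (Ordinal (ltn_pmod m n_gt0))) := eq_w; rewrite !ffunE.
have [u uE] := orbit_perm x s_cyc; have [v vE] := orbit_perm y t_cyc.
have eq_uv : u = v.
  apply: perm_order_eq => i j; rewrite !uE !vE.
  exact: orbit_word_order eq_b _ _.
have eq_it m : iter m s x = iter m t y.
  rewrite -(@iter_modn _ s n) ?iter_full_cycle // -(@iter_modn _ t n) ?iter_full_cycle //.
  by rewrite -(uE (Ordinal (ltn_pmod m n_gt0))) eq_uv vE.
congr pair; last exact: eq_it 0.
apply/permP => z; have [i ->] : exists i, z = iter i s x.
  have : z \in porbit s x by rewrite porbit_full_cycle // inE.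
  by move=> /porbitP[i ->]; exists i; rewrite permX.
by rewrite -[s _]/(iter i.+1 s x) eq_it /= eq_it.
Qed.

Lemma card_pointed_cycles n (P : pred 'S_n) :
  #|[set p : 'S_n * 'I_n | (p.1 \in full_cycles n) && P p.1]| =
  n * #|[set s in full_cycles n | P s]|.
Proof.
rewrite mulnC -[X in _ * X]card_ord -cardsT -cardsX; apply: eq_card => p.
by rewrite !inE andbT.
Qed.

Lemma cyclic_le_words n (b : 'I_n -> 'I_n) : {homo b : x y / x <= y} ->
  n * #|[set s in full_cycles n | increasing_on_blocks b s]| <= #|words b|.
Proof.
move=> b_homo; rewrite -card_pointed_cycles -(card_in_imset (orbit_word_inj b_homo)).
apply/subset_leq_card/subsetP => _ /imsetP[p + ->]; rewrite inE => /andP[p_cyc _].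
exact: orbit_word_mem.
Qed.

(** * Words with distinct rotations *)

(** The number with base B digits u 0, ..., u (k-1), the first one being the most
significant. *)
Fixpoint radix B (u : nat -> nat) k : nat :=
  if k is k'.+1 then radix B u k' * B + u k' else 0.

Lemma radix_lt B u k : (forall m, u m < B) -> radix B u k < B ^ k.
Proof.
move=> u_lt; elim: k => //= k IHk; have := u_lt k.
by rewrite expnS; nia.
Qed.

Lemma radix_recl B u k :
  radix B u k.+1 = u 0 * B ^ k + radix B (fun m => u m.+1) k.
Proof. by elim: k => [|k /= ->]; rewrite ?expnS //=; nia. Qed.

Lemma eq_radix B u v k : (forall m, u m = v m) -> radix B u k = radix B v k.
Proof. by move=> eq_uv; elim: k => //= k ->; rewrite eq_uv. Qed.

Lemma iter_ordS n k (i : 'I_n) : iter k (@ordS n) i = (i + k) %% n :> nat.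
Proof.
elim: k => [|k IHk] /=; first by rewrite addn0 modn_small.
by rewrite IHk addnS -[in LHS]addn1 modnDml addn1.
Qed.

Lemma iter_ordS_id n (i : 'I_n) : iter n (@ordS n) i = i.
Proof. by apply/ord_inj; rewrite iter_ordS modnDr modn_small. Qed.

(** Comparing these numbers is comparing the rotations of w
lexicographically. *)
Definition rotation_value n (w : 'I_n -> 'I_n) (i : 'I_n) : nat :=
  radix n (fun m => w (iter m (@ordS n) i)) n.

(** A rotation moves the leading digit to the end. *)
Lemma rotation_value_ordS n (w : 'I_n -> 'I_n) i :
  rotation_value w (ordS i) + w i * n ^ n = rotation_value w i * n + w i.
Proof.
pose u m : nat := w (iter m (@ordS n) i).
have := radix_recl n u n; rewrite /= {2}/u iter_ordS_id => ->.
rewrite addnC; congr (_ + _); apply: eq_radix => m.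
by rewrite /u -iterSr.
Qed.

Lemma rotation_value_lt n (w : 'I_n -> 'I_n) i j :
  w i < w j -> rotation_value w i < rotation_value w j.
Proof.
move=> lt_w; have n_gt0 : 0 < n by apply: leq_ltn_trans (ltn_ord i).
have top k : exists2 r, r < n ^ n.-1 & rotation_value w k = w k * n ^ n.-1 + r.
  pose u m : nat := w (iter m (@ordS n) k).
  exists (radix n (fun m => u m.+1) n.-1).
    by apply: radix_lt => m; apply: ltn_ord.
  by rewrite -(radix_recl n u) prednK.
have [r lt_r ->] := top i; have [q _ ->] := top j; nia.
Qed.

Definition periodic_words n : {set {ffun 'I_n -> 'I_n}} :=
  [set w : {ffun 'I_n -> 'I_n} |
    [exists k : 'I_n, (0 < k) && [forall x, w (iter k (@ordS n) x) == w x]]].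

(** Equal values have equal leading digits, and rotating both keeps the values
equal; so all letters of the two rotations agree, and their distance is a
period of w. *)
Lemma rotation_value_inj n (w : {ffun 'I_n -> 'I_n}) :
  w \notin periodic_words n -> injective (rotation_value w).
Proof.
move=> w_aper i j eqN.
have eq_w m : w (iter m (@ordS n) i) = w (iter m (@ordS n) j) /\
   rotation_value w (iter m (@ordS n) i) = rotation_value w (iter m (@ordS n) j).
  have first_eq i' j' : rotation_value w i' = rotation_value w j' -> w i' = w j'.
    move=> eqN'; apply/ord_inj/anti_leq.
    have nlt x y : rotation_value w x = rotation_value w y -> w y <= w x.
      move=> eqxy; rewrite leqNgt; apply/negP => /(@rotation_value_lt n w x y).
      by rewrite eqxy ltnn.
    by rewrite (nlt _ _ eqN') (nlt _ _ (esym eqN')).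
  elim: m => [|m [eqw eqv]] /=; first by split=> //; apply: first_eq.
  suff eqv' : rotation_value w (ordS (iter m (@ordS n) i)) =
              rotation_value w (ordS (iter m (@ordS n) j)).
    by split=> //; apply: first_eq.
  apply/eqP; rewrite -(eqn_add2r (w (iter m (@ordS n) i) * n ^ n)).
  by rewrite {2}eqw !rotation_value_ordS eqw eqv.
have sep (i' j' : 'I_n) : i' < j' ->
    (forall m, w (iter m (@ordS n) i') = w (iter m (@ordS n) j')) -> False.
  move=> lt_ij eq_m; case/negP: w_aper; rewrite in_set; apply/existsP.
  have lt_k : j' - i' < n by apply: leq_ltn_trans (ltn_ord j'); apply: leq_subr.
  exists (Ordinal lt_k); rewrite subn_gt0 lt_ij /=; apply/forallP => x.
  have xE : x = iter (x + (n - i')) (@ordS n) i'.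
    apply/ord_inj; rewrite iter_ordS addnCA subnKC ?(ltnW (ltn_ord _)) //.
    by rewrite modnDr modn_small.
  rewrite [in X in _ == X]xE eq_m; apply/eqP; congr (w _); apply/ord_inj.
  rewrite !iter_ordS /=.
  suff -> : j' + (x + (n - i')) = x + (j' - i') + n by rewrite modnDr.
  by rewrite addnCA -addnA addnBA ?(ltnW (ltn_ord _)) // addnBAC // ltnW.
have [lt|lt|/ord_inj //] := ltngtP i j.
  by case: (sep _ _ lt) => m; have [-> _] := eq_w m.
by case: (sep _ _ lt) => m; have [-> _] := eq_w m.
Qed.

Lemma conj_ordS_iter n (s : 'S_n) m i :
  iter m (s^-1 * perm (@ordS_inj n) * s)%g (s i) = s (iter m (@ordS n) i).
Proof. by elim: m => //= m ->; rewrite !permM permK permE. Qed.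

Lemma conj_ordS_full_cycle n (s : 'S_n) : 0 < n ->
  (s^-1 * perm (@ordS_inj n) * s)%g \in full_cycles n.
Proof.
move=> n_gt0; set t := (_ * s)%g.
have porb x : porbit t x = [set: 'I_n].
  apply/setP => y; rewrite [RHS]inE; apply/porbitP.
  exists ((s^-1)%g y + (n - (s^-1)%g x)).
  rewrite permX -{2}[x](permKV s) conj_ordS_iter.
  apply: (@perm_inj _ (s^-1)%g); rewrite permK; apply/ord_inj.
  rewrite iter_ordS addnCA subnKC ?(ltnW (ltn_ord _)) //.
  by rewrite modnDr modn_small.
rewrite inE; apply/eqP/setP => A; rewrite in_set1.
apply/imsetP/eqP => [[x _ ->] //|->].
by exists (Ordinal n_gt0).
Qed.

(** The cycle is the cyclic shift of the positions of w, transported by the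
ranking s of the rotations.  It increases on blocks because removing a common
first letter from two rotations, and appending it at the end, does not change
their order. *)
Lemma aperiodic_orbit_word n (b : 'I_n -> 'I_n) w : 0 < n ->
  {homo b : x y / x <= y} -> w \in words b -> w \notin periodic_words n ->
  exists2 p : 'S_n * 'I_n,
    (p.1 \in full_cycles n) && increasing_on_blocks b p.1 & w = orbit_word b p.
Proof.
move=> n_gt0 b_homo /imsetP[t _ wE] /rotation_value_inj/rank_perm[s sE].
have bs i : b (s i) = w i.
  rewrite wE ffunE; apply: sort_word => // {}i j lt_b; rewrite sE.
  by apply: rotation_value_lt; rewrite wE !ffunE.
exists ((s^-1 * perm (@ordS_inj n) * s)%g, s (Ordinal n_gt0)) => /=; last first.
  apply/ffunP => i; rewrite ffunE /= conj_ordS_iter bs; congr (w _).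
  by apply/ord_inj; rewrite iter_ordS add0n modn_small.
rewrite conj_ordS_full_cycle //; apply/increasing_on_blocksP => x y.
rewrite -[x](permKV s) -[y](permKV s); move: (s^-1 x)%g (s^-1 y)%g => i j.
rewrite !bs => lt_s eq_w; have := conj_ordS_iter s 1; rewrite /= => cE.
rewrite !cE sE; move: lt_s; rewrite sE => lt_v.
rewrite -(ltn_add2r (w i * n ^ n)) {2}eq_w !rotation_value_ordS eq_w.
by rewrite ltn_add2r ltn_pmul2r.
Qed.

Lemma words_le_cyclic n (b : 'I_n -> 'I_n) : 0 < n -> {homo b : x y / x <= y} ->
  #|words b| <= n * #|[set s in full_cycles n | increasing_on_blocks b s]| +
               #|periodic_words n|.
Proof.
move=> n_gt0 b_homo; rewrite -card_pointed_cycles; set P := [set p | _].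
apply: leq_trans (leq_add (leq_imset_card (orbit_word b) P) (leqnn _)).
apply: leq_trans (leq_card_setU _ _); apply/subset_leq_card/subsetP => w ww.
rewrite inE orbC; have [//|/= w_aper] := boolP (w \in periodic_words n).
have [p Pp ->] := aperiodic_orbit_word n_gt0 b_homo ww w_aper.
by apply: imset_f; rewrite in_set.
Qed.

(** Together with k, also n - k is a period, and the smaller of the two is at
most n/2; so the first half of the word determines the rest. *)
Lemma card_periodic_words n : #|periodic_words n| <= n * n ^ n./2.
Proof.
pose per (k : nat) : {set {ffun 'I_n -> 'I_n}} :=
  [set w : {ffun 'I_n -> 'I_n} | [forall x, w (iter k (@ordS n) x) == w x]].
have perP k (w : {ffun 'I_n -> 'I_n}) :
    reflect (forall x, w (iter k (@ordS n) x) = w x) (w \in per k).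
  by rewrite in_set; apply: (iffP forallP) => H x; apply/eqP/H.
have card_per (k : 'I_n) : 0 < k -> #|per k| <= n ^ n./2.
  move=> k_gt0.
  have [k' [k'_gt0 k'_le sub]] : exists k', [/\ 0 < k', k' <= n./2 & per k \subset per k'].
    have [le_k | lt_k] := leqP k n./2; first by exists k.
    exists (n - k); split; [by rewrite subn_gt0 | by move: lt_k; lia |].
    apply/subsetP => w /perP kw; apply/perP => x.
    by rewrite -kw -iterD subnKC ?iter_ordS_id // ltnW.
  apply: leq_trans (subset_leq_card sub) _.
  have half_le : n./2 <= n by rewrite -{2}(half_bit_double n false) leq_half_double; lia.
  pose r (w : {ffun 'I_n -> 'I_n}) : {ffun 'I_n./2 -> 'I_n} :=
    [ffun i => w (widen_ord half_le i)].
  have r_inj : {in per k' &, injective r}.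
    move=> w v /perP kw /perP kv eq_r.
    suff eq_wv m (lt_m : m < n) : w (Ordinal lt_m) = v (Ordinal lt_m).
      by apply/ffunP => -[].
    elim/ltn_ind: m lt_m => m IHm lt_m.
    have [lt_h | le_h] := ltnP m n./2.
      have /ffunP/(_ (Ordinal lt_h)) := eq_r; rewrite !ffunE.
      by congr (w _ = v _); apply/ord_inj.
    have lt_m' : m - k' < n by apply: leq_ltn_trans lt_m; apply: leq_subr.
    have -> : Ordinal lt_m = iter k' (@ordS n) (Ordinal lt_m').
      apply/ord_inj; rewrite iter_ordS /= subnK ?modn_small //.
      exact: leq_trans le_h.
    by rewrite kw kv IHm //; move: k'_gt0 k'_le le_h; clear; lia.
  rewrite -(card_in_imset r_inj); apply: leq_trans (max_card _) _.
  by rewrite card_ffun !card_ord.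
have sub : periodic_words n \subset \bigcup_(k < n | 0 < k) per k.
  apply/subsetP => w; rewrite in_set => /existsP[k /andP[k_gt0 wk]].
  by apply/bigcupP; exists k; rewrite // in_set.
apply: leq_trans (subset_leq_card sub) _.
have le_sum : #|\bigcup_(k < n | 0 < k) per k| <= \sum_(k < n | 0 < k) #|per k|.
  elim/big_rec2: _ => [|k m A _ le_m]; first by rewrite cards0.
  by apply: leq_trans (leq_card_setU _ _) _; rewrite leq_add2l.
apply: leq_trans le_sum _.
apply: (@leq_trans (\sum_(k < n) n ^ n./2)); last by rewrite sum_nat_const card_ord.
rewrite [leqRHS](bigID (fun k : 'I_n => 0 < k)) /=.
by apply: leq_trans (leq_addr _ _); apply: leq_sum.
Qed.

(** * Inclusion and exclusion *)

(** Requiring one more element i in D t amounts to subtracting the sum over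
D t contained in J minus i, so each element of the lower bound on D t at most
doubles the error. *)
Lemma incl_excl_bound (R : numDomainType) (T I : finType) (D : T -> {set I})
    (f : T -> R) (E : R) :
  (forall J : {set I}, `|\sum_(t | D t \subset J) f t| <= E)%R ->
  forall J : {set I}, (`|\sum_(t | D t == J) f t| <= E *+ (2 ^ #|J|))%R.
Proof.
move=> bnd J.
(* K is the lower bound on D t; it grows from set0 to J, one element at a time. *)
have gen k : forall K J : {set I}, #|K| = k ->
    (`|\sum_(t | (K \subset D t) && (D t \subset J)) f t| <= E *+ (2 ^ k))%R.
  elim: k => [|k IHk] K {}J cardK.
    move/eqP: cardK; rewrite cards_eq0 => /eqP ->; rewrite mulr1n.
    by under eq_bigl do rewrite sub0set; apply: bnd.
  have /card_gt0P[i iK] : 0 < #|K| by rewrite cardK.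
  have cardKi : #|K :\ i| = k.
    by move: cardK; rewrite (cardsD1 i) iK => -[].
  have split_i : (\sum_(t | (K \subset D t) && (D t \subset J)) f t =
      \sum_(t | (K :\ i \subset D t) && (D t \subset J)) f t -
      \sum_(t | (K :\ i \subset D t) && (D t \subset J :\ i)) f t)%R.
    apply/eqP; rewrite eq_sym subr_eq; apply/eqP.
    rewrite (bigID (fun t => i \in D t)) /=; congr (_ + _)%R; apply: eq_bigl => t.
      by rewrite -[in RHS](setD1K iK) subUset sub1set [LHS]andbC -[RHS]andbA.
    by rewrite subsetD1 andbA.
  rewrite split_i (le_trans (ler_normB _ _)) //.
  by rewrite expnS mul2n -addnn mulrnDr lerD // IHk.
by under eq_bigl do rewrite eq_sym eqEsubset; apply: gen.
Qed.

(** * A lower bound for beta *)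

(** Classify all permutations r by their height word h \o r, for which there are
L ^ n possibilities.  Two permutations r0 and r in the same class differ by one that
preserves h, and composing the latter with a fixed sorted permutation s0 gives
another sorted one; so no class is larger than the set of sorted
permutations. *)
Lemma fact_le_sorted n L (h : 'I_n -> 'I_L) :
  n`! <= L ^ n *
    #|[set s : 'S_n | [forall x : 'I_n, forall y : 'I_n, (h x < h y) ==> (s x < s y)]]|.
Proof.
set S := [set s | _].
have key_inj : injective (fun x => h x * n + x).
  move=> x y /(congr1 (modn^~ n)); rewrite !modnMDl !modn_small //.
  exact: ord_inj.
have [s0 s0E] := rank_perm key_inj.
have s0P x y : h x < h y -> s0 x < s0 y.
  move=> lt_h; rewrite s0E; have := leq_mul lt_h (leqnn n).
  rewrite mulSn => H; apply: leq_trans (leq_trans H (leq_addr _ _)).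
  by rewrite addnC ltn_add2r.
pose w (r : 'S_n) : {ffun 'I_n -> 'I_L} := [ffun i => h (r i)].
have fiber v : #|[set r | w r == v]| <= #|S|.
  have [->|[r0]] := set_0Vmem [set r | w r == v]; first by rewrite cards0.
  rewrite in_set => /eqP wr0.
  have inj : injective (fun r : 'S_n => (r0^-1 * r * s0)%g).
    by move=> r r' /mulIg/mulgI.
  rewrite -(card_imset _ inj); apply/subset_leq_card/subsetP => _ /imsetP[r + ->].
  rewrite in_set => /eqP wr; rewrite in_set.
  apply/forallP => x; apply/forallP => y; apply/implyP => lt_h.
  have hE z : h ((r0^-1 * r)%g z) = h z.
    rewrite permM; have : w r ((r0^-1)%g z) = w r0 ((r0^-1)%g z) by rewrite wr wr0.
    by rewrite !ffunE permKV.
  by rewrite permM [in X in _ < X]permM; apply: s0P; rewrite !hE.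
have -> : n`! = \sum_(v : {ffun 'I_n -> 'I_L}) #|[set r | w r == v]|.
  rewrite -card_Sn -sum1_card (partition_big w predT) //=.
  by apply: eq_bigr => v _; rewrite -sum1_card; apply: eq_bigl => r; rewrite in_set.
apply: leq_trans (leq_sum _ (fun v _ => fiber v)) _.
by rewrite sum_nat_const card_ffun !card_ord.
Qed.

Lemma fact_le_beta n L (h : 'I_n -> 'I_L) (I : {set 'I_n.-1}) :
  (forall j, if j \in I then h (succ_pos j) < h (pos j)
             else h (pos j) < h (succ_pos j)) ->
  n`! <= L ^ n * beta I.
Proof.
move=> hI; apply: leq_trans (fact_le_sorted h) _; rewrite leq_mul2l.
apply/orP; right; apply/subset_leq_card/subsetP => s.
rewrite in_set => /forallP sP; rewrite in_set; apply/eqP/setP => j.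
rewrite in_set; have := hI j; case: ifP => _ lt_h.
  by have /forallP/(_ (pos j))/implyP := sP (succ_pos j); apply.
by apply/negbTE; rewrite -leqNgt; apply/ltnW;
   have /forallP/(_ (succ_pos j))/implyP := sP (pos j); apply.
Qed.

(** * Sets without long runs *)
Definition interval n (p l : nat) : {set 'I_n} := [set j : 'I_n | p <= j < p + l].

Definition no_long_run n l (I : {set 'I_n}) : bool :=
  [forall p : 'I_n, (p + l <= n) ==>
     ~~ (interval n p l \subset I) && ~~ (interval n p l \subset ~: I)].

(** The positions that can be reached from x by walking downhill on the profile
of ascents and descents prescribed by I, to the left or to the right.  Their
number serves as the height of x. *)
Definition downhill n (I : {set 'I_n.-1}) (x : 'I_n) : {set 'I_n} :=
  [set m : 'I_n | (m < x) && [forall j : 'I_n.-1, (m <= j < x) ==> (j \notin I)]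
               || (x < m) && [forall j : 'I_n.-1, (x <= j < m) ==> (j \in I)]].

(** A walk in one direction stays in a run, hence makes fewer than l steps. *)
Lemma card_downhill n l (I : {set 'I_n.-1}) x : 0 < l -> no_long_run l I ->
  #|downhill I x| < 2 * l.
Proof.
move=> l_gt0 /forallP noI.
suff : #|downhill I x| <= (2 * l).-1 by move: l_gt0; clear; lia.
have x_lt : x <= n.-1 by rewrite -ltnS (ltn_predK (ltn_ord x)).
apply: (@card_window _ _ (x.+1 - l)) => m; rewrite in_set.
case/orP=> /andP[lt_m /forallP run].
  have lt_x : x < m + l.
    rewrite ltnNge; apply/negP => le_x.
    have lt_mn : m < n.-1 by apply: leq_trans x_lt.
    have /implyP/(_ (leq_trans le_x x_lt))/andP[_ /negP] := noI (Ordinal lt_mn).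
    case; apply/subsetP => j; rewrite !inE => /andP[le_j lt_j].
    by have /implyP := run j; apply; rewrite le_j (leq_trans lt_j).
  by move: (nat_of_ord x) (nat_of_ord m) lt_x lt_m l_gt0; clear; lia.
have lt_m' : m < x + l.
  rewrite ltnNge; apply/negP => le_m.
  have m_lt : m <= n.-1 by rewrite -ltnS (ltn_predK (ltn_ord m)).
  have lt_xn : x < n.-1 by apply: leq_trans m_lt.
  have /implyP/(_ (leq_trans le_m m_lt))/andP[/negP + _] := noI (Ordinal lt_xn).
  case; apply/subsetP => j; rewrite !inE => /andP[le_j lt_j].
  by have /implyP := run j; apply; rewrite le_j (leq_trans lt_j).
by move: (nat_of_ord x) (nat_of_ord m) lt_m' lt_m l_gt0; clear; lia.
Qed.

Lemma downhill_ascent n (I : {set 'I_n.-1}) j : j \notin I ->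
  downhill I (pos j) \proper downhill I (succ_pos j).
Proof.
move=> jI; apply/properP; split.
  apply/subsetP => m; rewrite !in_set => /orP[] /andP[lt_m /forallP run].
    rewrite /= ltnS (ltnW lt_m) /=; apply/orP; left; apply/forallP => i.
    rewrite ltnS (leq_eqVlt i); have [->|ne_ij] := eqVneq i j.
      by rewrite jI implybT.
    by rewrite (val_eqE i j) (negPf ne_ij).
  by have := run j; rewrite /= leqnn (negPf jI) implybF /= -ltnNge ltnS leqNgt lt_m.
exists (pos j); rewrite in_set /= ?ltnn // leqnn /=.
apply/orP; left; apply/forallP => i; rewrite ltnS -eqn_leq.
by apply/implyP => /eqP/ord_inj <-.
Qed.

Lemma downhill_descent n (I : {set 'I_n.-1}) j : j \in I ->
  downhill I (succ_pos j) \proper downhill I (pos j).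
Proof.
move=> jI; apply/properP; split.
  apply/subsetP => m; rewrite !in_set => /orP[] /andP[lt_m /forallP run].
    have := run j; rewrite jI implybF /= ltnSn andbT -ltnNge => lt_jm.
    by rewrite /= ltnS leqNgt lt_jm in lt_m.
  rewrite /= (ltn_trans (ltnSn j) lt_m) /=; apply/orP; right; apply/forallP => i.
  rewrite (leq_eqVlt j); have [->|ne_ij] := eqVneq i j.
    by rewrite jI implybT.
  by rewrite (val_eqE j i) eq_sym (negPf ne_ij) /=; apply: run.
exists (succ_pos j); rewrite in_set /= ?ltnn // leqnn /= orbC.
apply/orP; left; apply/forallP => i; rewrite ltnS -eqn_leq.
by apply/implyP => /eqP/ord_inj <-.
Qed.

Lemma fact_le_beta_no_long_run n l (I : {set 'I_n.-1}) : 0 < l ->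
  no_long_run l I -> n`! <= (2 * l) ^ n * beta I.
Proof.
move=> l_gt0 noI.
apply: (fact_le_beta (h := fun x => Ordinal (card_downhill x l_gt0 noI))) => j /=.
by case: ifPn => [/downhill_descent|/downhill_ascent]; apply: proper_card.
Qed.

Lemma card_interval n p l : p + l <= n -> l <= #|interval n p l|.
Proof.
move=> le_n.
have lt_n (i : 'I_l) : p + i < n by apply: leq_trans le_n; rewrite ltn_add2l.
have inj : injective (fun i => Ordinal (lt_n i)).
  by move=> i j /(congr1 val) /= /addnI/ord_inj.
rewrite -[X in X <= _]card_ord -cardsT -(card_imset _ inj).
apply/subset_leq_card/subsetP => _ /imsetP[i _ ->].
by rewrite in_set /= leq_addr ltn_add2l ltn_ord.
Qed.

(** A set I with a run in the window p, ..., p + l - 1 contains it or avoids it, so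
I or its complement is one of 2 ^ (n - l) subsets of the complement of the
window. *)
Lemma card_long_run n l :
  #|[set I : {set 'I_n} | ~~ no_long_run l I]| * 2 ^ l <= 2 * n * 2 ^ n.
Proof.
pose A (p : nat) := powerset (~: interval n p l).
pose B (p : nat) := A p :|: [set ~: I | I in A p].
have cardB (p : nat) : p + l <= n -> #|B p| * 2 ^ l <= 2 * 2 ^ n.
  move=> le_n.
  have cardA : #|A p| * 2 ^ l <= 2 ^ n.
    rewrite card_powerset -expnD leq_exp2l //.
    by rewrite -[leqRHS](card_ord n) -(cardsC (interval n p l)) addnC leq_add2r card_interval.
  rewrite mul2n -addnn (leq_trans _ (leq_add cardA cardA)) // -mulnDl leq_mul2r.
  apply/orP; right; apply: leq_trans (leq_card_setU _ _) _.
  by rewrite leq_add2l leq_imset_card.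
have sub : [set I : {set 'I_n} | ~~ no_long_run l I] \subset
    \bigcup_(p < n | p + l <= n) B p.
  apply/subsetP => I; rewrite in_set => /forallPn[p].
  rewrite negb_imply => /andP[le_n] run; apply/bigcupP; exists p => //.
  move: run; rewrite negb_and !negbK => /orP[] sub; rewrite in_setU; apply/orP.
    right; apply/imsetP; exists (~: I); last by rewrite setCK.
    by rewrite powersetE setCS.
  by left; rewrite powersetE -setCS setCK.
apply: leq_trans (leq_mul (subset_leq_card sub) (leqnn _)) _.
apply: (@leq_trans ((\sum_(p < n | p + l <= n) #|B p|) * 2 ^ l)).
  rewrite leq_mul2r; apply/orP; right.
  elim/big_rec2: _ => [|p m C _ le_m]; first by rewrite cards0.
  by apply: leq_trans (leq_card_setU _ _) _; rewrite leq_add2l.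
rewrite big_distrl /=; apply: (@leq_trans (\sum_(p < n | p + l <= n) 2 * 2 ^ n)).
  by apply: leq_sum => p; apply: cardB.
rewrite sum_nat_const mulnCA mulnA leq_mul2r; apply/orP; right.
by rewrite leq_mul2l /= (leq_trans (max_card _)) ?card_ord.
Qed.

(** * Size estimates *)

(** The product of n + 1, ..., 2n is n! times a binomial coefficient of 2n, which is
at most 4 ^ n. *)
Lemma leq_expn_fact n : n ^ n <= 4 ^ n * n`!.
Proof.
have bin_le : 'C(n + n, n) <= 4 ^ n.
  rewrite -[4]/(2 ^ 2) -expnM mul2n -addnn -[2 in leqRHS]/(1 + 1) expnDn.
  have lt_n : n < (n + n).+1 by rewrite ltnS leq_addr.
  by rewrite (bigD1 (Ordinal lt_n)) //= !exp1n !muln1 leq_addr.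
rewrite (leq_trans _ (leq_mul bin_le (leqnn _))) // bin_ffact ffact_prod.
rewrite -[X in X ^ _]/(id n) -[X in _ ^ X]card_ord -prod_nat_const.
by apply: leq_prod => i _; rewrite -addnBA ?leq_addr // ltnW.
Qed.

(** After multiplication by 4 ^ n, the left side is bounded by
4^n * 4^n * 2^n * L^n * n^(n/2) = (32 L)^n n^(n/2), and (32 L)^n is at most
n^(n/2) up to rounding. *)
Lemma error_le_fact n L : (32 * L) ^ 2 <= n ->
  n * (2 ^ n * (n * n ^ n./2)) * L ^ n <= n`!.
Proof.
move=> le_n.
have [->//|n_gt0] := posnP n.
have n2 : n * n <= 4 ^ n.
  by rewrite -[4]/(2 * 2) expnMn leq_mul // ltnW // ltn_expl.
rewrite -(leq_pmul2l (expn_gt0 4 n)) (leq_trans _ (leq_expn_fact n)) //.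
have half : (32 * L) ^ n * n ^ n./2 <= n ^ n.
  have uphE : n = uphalf n + n./2 by rewrite addnC uphalf_half addnCA addnn odd_double_half.
  rewrite [leqRHS](_ : _ = n ^ uphalf n * n ^ n./2); last by rewrite -expnD -uphE.
  rewrite leq_mul2r; apply/orP; right.
  have [->|L_gt0] := posnP (32 * L); first by rewrite exp0n.
  apply: (@leq_trans (((32 * L) ^ 2) ^ uphalf n)).
    rewrite -expnM leq_pexp2l // mul2n uphalf_half doubleD.
    by rewrite -{1}(odd_double_half n) leq_add2r; case: (odd n).
  by rewrite leq_exp2r //; case: (n) n_gt0.
apply: leq_trans half.
have -> : (32 * L) ^ n = 4 ^ n * (2 ^ n * (4 ^ n * L ^ n)) by rewrite -!expnMn !mulnA.
rewrite -!mulnA leq_pmul2l ?expn_gt0 // mulnCA leq_pmul2l ?expn_gt0 //.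
rewrite mulnA [n ^ _ * L ^ _]mulnC mulnA [leqRHS]mulnA leq_mul2r.
by rewrite leq_mul2r n2 !orbT.
Qed.

(** * Comparison of beta and beta_cyc *)

Lemma sum_cycle_excess (R : numDomainType) n (P : pred 'S_n) :
  (\sum_(s | P s) (n%:R * (s \in full_cycles n)%:R - 1) =
   n%:R * #|[set s in full_cycles n | P s]|%:R - #|[set s | P s]|%:R :> R)%R.
Proof.
rewrite big_split /= -mulr_sumr sumrN -natr_sum; congr (_ * _ - _)%R.
  rewrite -big_mkcondr /= sum1_card; congr (_%:R)%R.
  by apply: eq_card => s; rewrite [RHS]in_set andbC.
by rewrite sumr_const; congr (_%:R)%R; apply: eq_card => s; rewrite [RHS]in_set.
Qed.

Lemma cycle_excess_le (R : numDomainType) n (J : {set 'I_n.-1}) : 0 < n ->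
  (`|\sum_(s | descent_set s \subset J) (n%:R * (s \in full_cycles n)%:R - 1)| <=
   (n * n ^ n./2)%:R :> R)%R.
Proof.
move=> n_gt0; under eq_bigl do rewrite descent_subset.
have b_homo := @block_homo n J.
have upper := words_le_cyclic n_gt0 b_homo.
have lower := cyclic_le_words b_homo.
rewrite sum_cycle_excess card_increasing // -natrM distrC -natrB // ger0_norm ?ler0n //.
rewrite ler_nat leq_subLR (leq_trans upper) // leq_add2l.
exact: card_periodic_words.
Qed.

Lemma beta_cyc_error (R : numDomainType) n (I : {set 'I_n.-1}) : 0 < n ->
  (`|n%:R * (beta_cyc I)%:R - (beta I)%:R| <=
   (2 ^ n * (n * n ^ n./2))%:R :> R)%R.
Proof.
move=> n_gt0; rewrite -sum_cycle_excess.
apply: le_trans (incl_excl_bound (fun J => cycle_excess_le R J n_gt0) I) _.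
rewrite -mulrnA ler_nat mulnC leq_mul2r leq_exp2l //.
by rewrite (leq_trans (max_card _)) ?orbT // card_ord leq_pred.
Qed.

(** * The family of sets without long runs *)
Lemma sqr_leq_exp2 m : (m + 25) ^ 2 <= 2 ^ (m + 10).
Proof.
elim: m => // m IHm; rewrite !addSn [leqRHS]expnS.
apply: leq_trans (leq_mul (leqnn 2) IHm); rewrite !expnS !expn0; nia.
Qed.

(** About 2 log_2 n: large enough for 2 ^ run_bound n to exceed n ^ 2, and still far
below the square root of n. *)
Definition run_bound n := 2 * (trunc_log 2 n).+1.

Lemma sqr_leq_exp2_run_bound n : n.+1 ^ 2 <= 2 ^ run_bound n.
Proof. by rewrite /run_bound mulnC expnM leq_exp2r // trunc_log_ltn. Qed.

Lemma run_bound_small n : 2 ^ 24 <= n -> (32 * (2 * run_bound n)) ^ 2 <= n.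
Proof.
move=> le_n; have n_gt0 : 0 < n by apply: leq_trans le_n; rewrite expn_gt0.
have := trunc_logP (isT : 1 < 2) n_gt0; apply: leq_trans.
have le_k : 24 <= trunc_log 2 n by apply: trunc_log_max.
rewrite /run_bound; move: (trunc_log 2 n) le_k => k le_k.
rewrite !mulnA -[32 * 2 * 2]/(2 ^ 7) expnMn -expnM.
have kE : k = (k - 24) + 24 by rewrite subnK.
rewrite [in X in _ <= X]kE (_ : k.+1 = k - 24 + 25); last by rewrite addnS -kE.
rewrite -[24]/(7 * 2 + 10) [in X in _ <= X]addnCA expnD leq_mul2l orbC.
by rewrite sqr_leq_exp2.
Qed.

Lemma beta_ratio (R : realType) n (I : {set 'I_n.-1}) : 2 ^ 24 <= n ->
  no_long_run (run_bound n) I ->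
  (`|n%:R * (beta_cyc I)%:R / (beta I)%:R - 1| <= n%:R^-1 :> R)%R.
Proof.
move=> n_large good; have n_gt0 : 0 < n by apply: leq_trans n_large; rewrite expn_gt0.
have rb_gt0 : 0 < run_bound n by [].
have beta_ge := fact_le_beta_no_long_run rb_gt0 good.
have err_le := error_le_fact (run_bound_small n_large).
have b_gt0 : 0 < beta I.
  by have := leq_trans (fact_gt0 n) beta_ge; rewrite muln_gt0 => /andP[].
have err_beta : n * (2 ^ n * (n * n ^ n./2)) <= beta I.
  have L_gt0 : 0 < (2 * run_bound n) ^ n by rewrite expn_gt0.
  by rewrite -(leq_pmul2r L_gt0) (leq_trans err_le) // mulnC.
have bR : (0 < (beta I)%:R :> R)%R by rewrite ltr0n.
rewrite -[X in (_ - X)%R](divff (lt0r_neq0 bR)) -mulrBl normrM normfV.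
rewrite [X in (_ / X)%R]ger0_norm ?ler0n // ler_pdivrMr //.
apply: le_trans (beta_cyc_error R I n_gt0) _.
by rewrite mulrC ler_pdivlMr ?ltr0n // -natrM ler_nat mulnC.
Qed.

Lemma card_no_long_run_ratio (R : realType) n : 0 < n ->
  (1 - 2 / n%:R <= (
   #|[set I : {set 'I_n.-1} | no_long_run (run_bound n) I]|%:R / (2 ^ n.-1)%:R : R) <= 1)%R.
Proof.
move=> n_gt0; set G := [set I | _].
have pow_gt0 : (0 < (2 ^ n.-1)%:R :> R)%R by rewrite ltr0n expn_gt0.
have cardT : #|G| + #|~: G| = 2 ^ n.-1.
  by rewrite cardsC -cardsT -powersetT card_powerset cardsT card_ord.
have bad : #|~: G| * n <= 2 * 2 ^ n.-1.
  have := card_long_run n.-1 (run_bound n).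
  have -> : #|[set I : {set 'I_n.-1} | ~~ no_long_run (run_bound n) I]| = #|~: G|.
    by apply: eq_card => I; rewrite !inE.
  move=> le_bad; rewrite -(leq_pmul2r n_gt0).
  have pw : n * n <= 2 ^ run_bound n.
    by apply: leq_trans (sqr_leq_exp2_run_bound n); rewrite leq_mul.
  rewrite -mulnA (leq_trans (leq_mul (leqnn _) pw)) // (leq_trans le_bad) //.
  by rewrite mulnAC leq_mul2l leq_pred orbT.
apply/andP; split; last first.
  by rewrite ler_pdivrMr // mul1r ler_nat -cardT leq_addr.
rewrite ler_pdivlMr // mulrBl mul1r lerBlDr -[X in (X%:R <= _)%R]cardT natrD lerD2l.
by rewrite mulrAC ler_pdivlMr ?ltr0n // -!natrM ler_nat.
Qed.

Local Open Scope classical_set_scope.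
Local Open Scope ring_scope.

Theorem corollary5p13 (R : realType) :
  exists Ic : forall n : nat, {set {set 'I_n.-1}},
    asymp_equiv (fun n => #|Ic n|%:R : R) (fun n => (2 ^ n.-1)%N%:R) /\
    (fun n => \big[Num.max/0]_(I in Ic n)
                `| n%:R * (beta_cyc I)%:R / (beta I)%:R - 1 : R |)
      @ \oo --> (0 : R).
Proof.
have inv_cvg : (fun n : nat => (n%:R)^-1 : R) @ \oo --> (0 : R).
  by rewrite -cvg_shiftS; apply: cvg_harmonic.
exists (fun n => [set I : {set 'I_n.-1} | no_long_run (run_bound n) I]%SET); split.
  have low_cvg : (fun n : nat => 1 - 2 / n%:R : R) @ \oo --> (1 : R).
    have := cvgB (cvg_cst (1 : R)) (cvgM (cvg_cst (2 : R)) inv_cvg).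
    by rewrite mulr0 subr0; apply.
  have ratio_cvg :
      (fun n => #|[set I : {set 'I_n.-1} | no_long_run (run_bound n) I]%SET|%:R / (2 ^ n.-1)%N%:R : R) @ \oo --> (1 : R).
    apply: (squeeze_cvgr _ low_cvg (cvg_cst (1 : R))); near=> n.
    by apply: card_no_long_run_ratio; near: n; exact: nbhs_infty_ge.
  rewrite /asymp_equiv; under eq_fun do rewrite -invf_div.
  by have := cvgV (oner_neq0 R) ratio_cvg; rewrite invr1; apply.
apply: (squeeze_cvgr _ (cvg_cst (0 : R)) inv_cvg).
near=> n; apply/andP; split; first by apply: bigmax_ge_id.
apply: bigmax_le => [|I]; first by rewrite invr_ge0.
rewrite in_set; apply: beta_ratio.
near: n; exact: nbhs_infty_ge.
Unshelve. all: by end_near.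
Qed.
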